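(* Let $C$ be a commutative principal ideal domain with infinitely many prime ideals, and let $P_0$, $P_1$ be two disjoint infinite sets of nonzero prime ideals of $C$. Let $C^+$ be the commutative $C$-algebra obtained by adjoining to $C$ an indeterminate $y_p$ for each $p\in P_0\cup P_1$, and imposing the relations $p\,y_p=\{0\}$ (i.e. $c\,y_p=0$ for all $c\in p$) for each such $p$. Then for $k$, $A$, $M$, $B$, $N$ specified in each of the following three ways, the $A$-module $M$ and the $B$-module $N$ are faithful, and $A\otimes_k B$ is nonzero, but $M\otimes_k N$ is zero, hence is not faithful as an $A\otimes_k B$-module. Moreover, in each case the additional property stated at the end of the item holds. (i) Let $A=B=k=C$, and let $M=\bigoplus_{p\in P_0}k/p$ and $N=\bigoplus_{p\in P_1}k/p$. In this case, every finite subset of $A$ lies in a free $k$-submodule of $A$, and every finite subset of $B$ lies in a free $k$-submodule of $B$. (ii) Let $k=C^+$, let $M$ be the ideal of $k$ generated by the $y_p$ for $p\in P_0$, let $N$ be the ideal of $k$ generated by the $y_p$ for $p\in P_1$, let $A=k/N$, and let $B=k/M$. Here $MN=\{0\}$, so $M$ may be regarded as an $A$-module and $N$ as a $B$-module. In this case, $M$ and $N$ embed in $k$, hence $k$-module homomorphisms $M\to k$ separate elements of $M$, and $k$-module homomorphisms $N\to k$ separate elements of $N$. (iii) Let $k=A=C^+$, and let $M$ be the ideal of $A$ generated by all the $y_p$ ($p\in P_0\cup P_1$). Let $B$ be the field of fractions of $C$, made a $k$-algebra by first mapping $k$ to $C$ by sending all the $y_p$ to $0$, and then mapping $C$ to its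 field of fractions; and let $N$ be any nonzero $B$-vector-space. In this case, every finite subset of $A$ lies in a free $k$-submodule of $A$, and $k$-module homomorphisms $M\to k$ separate elements of $M$.
   Context: A module over a $k$-algebra $A$ is faithful if every nonzero element of $A$ acts as a nonzero map on it. Given a left $A$-module $M$ and a left $B$-module $N$, the $k$-module $M\otimes_k N$ is a left $A\otimes_k B$-module via: $f=\sum_i a_i\otimes b_i\in A\otimes_k B$ acts by $u\otimes v\mapsto\sum_i a_iu\otimes b_iv$ ($u\in M$, $v\in N$), extended $k$-linearly. Saying that $k$-module homomorphisms $M\to k$ separate elements of $M$ means that for any two distinct $x,y\in M$ there is a $k$-module homomorphism $\varphi:M\to k$ with $\varphi(x)\ne\varphi(y)$. *)

(* Defs.v *)
From HB Require Import structures.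
From mathcomp Require Import all_boot all_algebra.
From mathcomp Require Import boolp classical_sets cardinality.
From mathcomp Require Import finmap monalg.

Set Implicit Arguments.
Unset Strict Implicit.
Unset Printing Implicit Defensive.

Import GRing.Theory.

Local Open Scope classical_set_scope.
Local Open Scope quotient_scope.
Local Open Scope ring_scope.

(* The submodule generated by X, as a boolean predicate (so that it can serve
   as a [submodClosed]). *)
Definition span (R : pzRingType) (V : lmodType R) (X : set V) : {pred V} :=
  fun v => `[< exists n (a : 'I_n -> R) (x : 'I_n -> V),
    (forall i, X (x i)) /\ v = \sum_i a i *: x i >].

Section Span.
Variables (R : pzRingType) (V : lmodType R) (X : set V).

Lemma span_gen x : X x -> x \in span X.
Proof.
move=> Xx; apply/asboolP; exists 1%N, (fun=> 1), (fun=> x).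
by rewrite big_ord1 scale1r.
Qed.

Lemma span_submod_closed : submod_closed (span X).
Proof.
split=> [|c u v /asboolP[n [a [x [Xx ->]]]] /asboolP[m [b [y [Xy ->]]]]].
  by apply/asboolP; exists 0%N, (fun=> 0), (fun=> 0); rewrite big_ord0; split=> // -[].
apply/asboolP; exists (n + m)%N,
  (fun i => match split i with inl j => c * a j | inr j => b j end),
  (fun i => match split i with inl j => x j | inr j => y j end).
split=> [i|]; first by case: (split i).
rewrite big_split_ord /= scaler_sumr; congr (_ + _); apply: eq_bigr => i _.
  by rewrite -[lshift m i]/(unsplit (inl i)) unsplitK scalerA.
by rewrite -[rshift n i]/(unsplit (inr i)) unsplitK.
Qed.

HB.instance Definition _ := GRing.isSubmodClosed.Build R V (span X)
  span_submod_closed.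

Lemma span_min (S : submodClosed V) : (forall x, X x -> x \in S) ->
  forall v, v \in span X -> v \in S.
Proof.
move=> XS v /asboolP[n [a [x [Xx ->]]]].
by apply: rpred_sum => i _; apply/rpredZ/XS.
Qed.

End Span.

Section Submodule.
Variables (R : pzRingType) (V : lmodType R) (S : submodClosed V).

Record submod := Submod { submod_val :> V; submod_valP : submod_val \in S }.

HB.instance Definition _ := [isSub for submod_val].
HB.instance Definition _ := [Choice of submod by <:].
HB.instance Definition _ := [SubChoice_isSubLmodule of submod by <:].
End Submodule.

Section QuotientModule.
Variables (R : pzRingType) (V : lmodType R) (S : submodClosed V).

(* [submodClosed] records no closure under opposites, which the quotient needs. *)
Definition zclosed : {pred V} := S.
HB.instance Definition _ := GRing.isZmodClosed.Build V zclosed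
  (GRing.submod_closedB (GRing.submodClosedP S)).

Definition quotmod : Type := Quotient.quot zclosed.
HB.instance Definition _ := GRing.Zmodule.on quotmod.

Definition qpi (v : V) : quotmod := \pi_(Quotient.quot zclosed) v.

Lemma qpi_is_zmod_morphism : zmod_morphism qpi.
Proof. exact: raddfB. Qed.
HB.instance Definition _ :=
  GRing.isZmodMorphism.Build V quotmod qpi qpi_is_zmod_morphism.

Lemma qpi_eq0 v : (qpi v == 0) = (v \in S).
Proof.
by rewrite -[v in RHS]subr0 -[S : {pred V}]/zclosed Quotient.idealrBE /qpi -[0 in LHS](raddf0 qpi).
Qed.

Definition qrepr (q : quotmod) : V := repr (q : Quotient.quot zclosed).

Lemma qreprK : cancel qrepr qpi.
Proof. exact: reprK. Qed.

Lemma qpiP (q : quotmod) : exists v, q = qpi v.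
Proof. by exists (qrepr q); rewrite qreprK. Qed.

Definition qscale (a : R) (q : quotmod) : quotmod :=
  qpi (a *: qrepr q).

Lemma qscale_pi a v : qscale a (qpi v) = qpi (a *: v).
Proof.
apply/eqP; rewrite -subr_eq0 -raddfB qpi_eq0 -scalerBr; apply: rpredZ.
by rewrite -qpi_eq0 raddfB subr_eq0 /= qreprK.
Qed.

Fact qscaleA a b q : qscale a (qscale b q) = qscale (a * b) q.
Proof. by have [v ->] := qpiP q; rewrite !qscale_pi scalerA. Qed.
Fact qscale1 : left_id 1 qscale.
Proof. by move=> q; have [v ->] := qpiP q; rewrite qscale_pi scale1r. Qed.
Fact qscaleDr : right_distributive qscale +%R.
Proof.
move=> a p q; have [u ->] := qpiP p; have [v ->] := qpiP q.
by rewrite -raddfD !qscale_pi scalerDr raddfD.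
Qed.
Fact qscaleDl q : {morph qscale^~ q : a b / a + b}.
Proof.
by move=> a b; have [v ->] := qpiP q; rewrite !qscale_pi scalerDl raddfD.
Qed.
HB.instance Definition _ := GRing.Zmodule_isLmodule.Build R quotmod
  qscaleA qscale1 qscaleDr qscaleDl.

Fact qpi_scalable : scalable qpi.
Proof. by move=> a v; rewrite -qscale_pi. Qed.
HB.instance Definition _ := GRing.isScalable.Build R V quotmod *:%R qpi
  qpi_scalable.

Section Lift.
Variables (W : lmodType R) (f : {linear V -> W}).
Hypothesis f0 : forall v, v \in S -> f v = 0.

Definition qlift (q : quotmod) : W := f (qrepr q).

Lemma qlift_pi v : qlift (qpi v) = f v.
Proof.
by apply/eqP; rewrite /qlift -subr_eq0 -linearB f0 // -qpi_eq0 raddfB subr_eq0 /= qreprK.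
Qed.

Lemma qlift_is_linear : linear qlift.
Proof.
move=> a p q; have [u ->] := qpiP p; have [v ->] := qpiP q.
by rewrite -linearP !qlift_pi linearP.
Qed.
End Lift.

End QuotientModule.

Section DirectSum.
Variables (R : pzRingType) (I : Type) (F : I -> lmodType R).

Definition dprod : Type := forall i, F i.
HB.instance Definition _ := Choice.on dprod.

Definition dprod_zero : dprod := fun i => 0.
Definition dprod_plus (f g : dprod) : dprod := fun i => f i + g i.
Definition dprod_opp (f : dprod) : dprod := fun i => - f i.
Definition dprod_scale (a : R) (f : dprod) : dprod := fun i => a *: f i.

Fact dprod_addA : associative dprod_plus.
Proof. by move=> f g h; apply: functional_extensionality_dep => i; apply: addrA. Qed.
Fact dprod_addC : commutative dprod_plus.
Proof. by move=> f g; apply: functional_extensionality_dep => i; apply: addrC. Qed.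
Fact dprod_add0 : left_id dprod_zero dprod_plus.
Proof. by move=> f; apply: functional_extensionality_dep => i; apply: add0r. Qed.
Fact dprod_addN : left_inverse dprod_zero dprod_opp dprod_plus.
Proof. by move=> f; apply: functional_extensionality_dep => i; apply: addNr. Qed.
HB.instance Definition _ := GRing.isZmodule.Build dprod
  dprod_addA dprod_addC dprod_add0 dprod_addN.

Fact dprod_scaleA a b f : dprod_scale a (dprod_scale b f) = dprod_scale (a * b) f.
Proof. by apply: functional_extensionality_dep => i; apply: scalerA. Qed.
Fact dprod_scale1 : left_id 1 dprod_scale.
Proof. by move=> f; apply: functional_extensionality_dep => i; apply: scale1r. Qed.
Fact dprod_scaleDr : right_distributive dprod_scale +%R.
Proof. by move=> a f g; apply: functional_extensionality_dep => i; apply: scalerDr. Qed.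
Fact dprod_scaleDl f : {morph dprod_scale^~ f : a b / a + b}.
Proof. by move=> a b; apply: functional_extensionality_dep => i; apply: scalerDl. Qed.
HB.instance Definition _ := GRing.Zmodule_isLmodule.Build R dprod
  dprod_scaleA dprod_scale1 dprod_scaleDr dprod_scaleDl.

Definition fin_supp : {pred dprod} :=
  fun f => `[< finite_set [set i | f i <> 0] >].

Lemma fin_supp_submod_closed : submod_closed fin_supp.
Proof.
split=> [|a f g /asboolP ff /asboolP fg]; apply/asboolP.
  by rewrite (_ : [set _ | _] = set0) // predeqE => i; split=> //= /(_ erefl).
apply: (@sub_finite_set _ _ ([set i | f i <> 0] `|` [set i | g i <> 0])).
  move=> i /= nz; have [fi0|] := pselect (f i = 0); last by left.
  right=> gi0; apply: nz; rewrite -[LHS]/(a *: f i + g i).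
  by rewrite fi0 gi0 scaler0 addr0.
by rewrite finite_setU.
Qed.
HB.instance Definition _ := GRing.isSubmodClosed.Build R dprod fin_supp
  fin_supp_submod_closed.

Definition dsum : Type := submod fin_supp.
HB.instance Definition _ := GRing.Lmodule.on dsum.

End DirectSum.

Section TensorModule.
Variables (k : comNzRingType) (M N : lmodType k).

Local Notation free := {malg k[(M * N)%type]}.
Local Notation "<[ x , y ]>" := (<< (x, y) >> : free).

Definition tens_rel : set free :=
  [set t | (exists a x x' y,
              t = <[a *: x + x', y]> - (a *: <[x, y]> + <[x', y]>))
        \/ (exists a x y y',
              t = <[x, a *: y + y']> - (a *: <[x, y]> + <[x, y']>))].

Definition tens : Type := quotmod (span tens_rel).
HB.instance Definition _ := GRing.Lmodule.on tens.

Definition tensor (x : M) (y : N) : tens := qpi (span tens_rel) <[x, y]>.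

Lemma tensorPl a x x' y :
  tensor (a *: x + x') y = a *: tensor x y + tensor x' y.
Proof.
apply/eqP; rewrite -linearP -subr_eq0 -linearB qpi_eq0.
by apply: span_gen; left; exists a, x, x', y.
Qed.

Lemma tensorPr a x y y' :
  tensor x (a *: y + y') = a *: tensor x y + tensor x y'.
Proof.
apply/eqP; rewrite -linearP -subr_eq0 -linearB qpi_eq0.
by apply: span_gen; right; exists a, x, y, y'.
Qed.

Lemma tens_sum (t : tens) : exists n (a : 'I_n -> k) (x : 'I_n -> M) (y : 'I_n -> N),
  t = \sum_i a i *: tensor (x i) (y i).
Proof.
have [g ->] := qpiP t; pose e := enum_fset (msupp g).
pose p (i : 'I_(size e)) := tnth (in_tuple e) i.
exists (size e), (fun i => g@_(p i)), (fun i => (p i).1), (fun i => (p i).2).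
rewrite [in LHS](monalgE g) linear_sum big_tnth; apply: eq_bigr => i _.
rewrite -linearZ /=; congr (qpi _ _); apply/malgP => j.
by rewrite mcoeffZ !mcoeffU mulr_natr -surjective_pairing.
Qed.

Lemma tens_ext (W : lmodType k) (f g : tens -> W) : linear f -> linear g ->
  (forall x y, f (tensor x y) = g (tensor x y)) -> f =1 g.
Proof.
move=> lf lg fg t; have [n [a [x [y ->]]]] := tens_sum t.
pose F := HB.pack_for {linear tens -> W} f (GRing.isLinear.Build k tens W _ f lf).
pose G := HB.pack_for {linear tens -> W} g (GRing.isLinear.Build k tens W _ g lg).
rewrite -[f _]/(F _) -[g _]/(G _) !linear_sum; apply: eq_bigr => i _.
by rewrite !linearZ /= fg.
Qed.

Section Lift.
Variables (W : lmodType k) (f : M -> N -> W).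

Definition free_lift (g : free) : W := \sum_(p <- msupp g) g@_p *: f p.1 p.2.

Lemma free_liftEw (d : {fset M * N}%fset) (g : free) : (msupp g `<=` d)%fset ->
  free_lift g = \sum_(p <- d) g@_p *: f p.1 p.2.
Proof.
move=> le; rewrite /free_lift; apply: big_fset_incl => // p _.
by move=> /mcoeff_outdom ->; rewrite scale0r.
Qed.

Lemma free_lift_is_linear : linear free_lift.
Proof.
move=> a g h; pose d := (msupp g `|` msupp h `|` msupp (a *: g + h))%fset.
rewrite !(@free_liftEw d) ?fsubsetUr //; first last.
- by rewrite /d -fsetUA fsubsetUl.
- by rewrite /d fsetUAC fsubsetUr.
rewrite scaler_sumr -big_split; apply: eq_bigr => p _.
by rewrite mcoeffD mcoeffZ scalerDl scalerA.
Qed.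
HB.instance Definition _ := GRing.isLinear.Build k free W _ free_lift
  free_lift_is_linear.

Lemma free_liftU x y : free_lift <[x, y]> = f x y.
Proof.
rewrite (@free_liftEw [fset (x, y)]%fset) ?big_seq_fset1 ?mcoeffUU ?scale1r //.
by rewrite msuppU; case: ifP.
Qed.

Definition bilinear_map := (forall y, linear (f^~ y)) /\ (forall x, linear (f x)).

Definition tens_lift : tens -> W := qlift free_lift.

Hypothesis bf : bilinear_map.

Fact free_lift0 v : v \in span tens_rel -> free_lift v = 0.
Proof.
move=> /asboolP[n [a [t [rt ->]]]].
rewrite linear_sum big1 // => i _; rewrite linearZ /=.
case: (rt i) => [[b [x [x' [y ->]]]]|[b [x [y [y' ->]]]]];
  rewrite linearB linearP /= !free_liftU.
  by rewrite bf.1 subrr scaler0.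
by rewrite bf.2 subrr scaler0.
Qed.

Lemma tens_lift_tensor x y : tens_lift (tensor x y) = f x y.
Proof. by rewrite /tens_lift (qlift_pi free_lift0) /= free_liftU. Qed.

Lemma tens_lift_is_linear : linear tens_lift.
Proof. exact: (qlift_is_linear free_lift0). Qed.
End Lift.

End TensorModule.

Lemma linear_comb (k : comNzRingType) (U W : lmodType k) (f g : U -> W) (c : k) :
  linear f -> linear g -> linear (fun u => c *: f u + g u).
Proof.
move=> lf lg e u v; rewrite lf lg !scalerDr !scalerA [e * c]mulrC.
by rewrite addrACA.
Qed.

(* [tens_act p q] maps [tensor a b] and [tensor x y] to
   [tensor (p a x) (q b y)] whenever p and q are bilinear. *)
Section TensorAction.
Variables (k : comNzRingType) (A B M N M' N' : lmodType k).
Variables (p : A -> M -> M') (q : B -> N -> N').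

Definition tens_act (f : tens A B) (t : tens M N) : tens M' N' :=
  tens_lift (fun a b => tens_lift (fun x y => tensor (p a x) (q b y)) t) f.

Hypotheses (bp : bilinear_map p) (bq : bilinear_map q).

Fact tens_act_bilin1 a b : bilinear_map (fun x y => tensor (p a x) (q b y)).
Proof.
by split=> [y|x] c u v; rewrite (bp.2, bq.2) (tensorPl, tensorPr).
Qed.

Fact tens_act_bilin2 t : bilinear_map
  (fun a b => tens_lift (fun x y => tensor (p a x) (q b y)) t).
Proof.
have lin a b := tens_lift_is_linear (tens_act_bilin1 a b).
split=> [b|a] c u v; move: t; apply: tens_ext => [||x y];
  (try exact: linear_comb) => //;
  rewrite !(tens_lift_tensor (tens_act_bilin1 _ _)).
  by rewrite bp.1 tensorPl.
by rewrite bq.1 tensorPr.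
Qed.

Lemma tens_act_tensor a b x y :
  tens_act (tensor a b) (tensor x y) = tensor (p a x) (q b y).
Proof.
rewrite /tens_act (tens_lift_tensor (tens_act_bilin2 _)).
exact: tens_lift_tensor (tens_act_bilin1 _ _) _ _.
Qed.

Lemma tens_act_bilinear : bilinear_map tens_act.
Proof.
split=> [t|f]; first exact: tens_lift_is_linear (tens_act_bilin2 t).
move=> c t t'; move: f; apply: tens_ext.
- exact: tens_lift_is_linear (tens_act_bilin2 _).
- by apply: linear_comb; apply: tens_lift_is_linear (tens_act_bilin2 _).
move=> a b; have E s := tens_lift_tensor (tens_act_bilin2 s) a b.
apply: etrans (E _) (etrans _ (esym (f_equal2 (fun u v => c *: u + v) (E t) (E t')))).
exact: tens_lift_is_linear (tens_act_bilin1 a b) c t t'.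
Qed.

End TensorAction.

Section TensorAlgebra.
Variables (k : comNzRingType) (A B : algType k).

Lemma mul_bilinear (D : algType k) : bilinear_map (@GRing.mul D).
Proof.
split=> [y|x] c u v; first by rewrite mulrDl scalerAl.
by rewrite mulrDr scalerAr.
Qed.

(* [tensalg A B] is only a [pzRingType]: it may be the zero ring. *)
Definition tensalg : Type := tens A B.
HB.instance Definition _ := GRing.Lmodule.on tensalg.

Definition tensalg_one : tensalg := tensor (1 : A) (1 : B).
Definition tensalg_mul : tensalg -> tensalg -> tensalg :=
  tens_act (@GRing.mul A) (@GRing.mul B).

Let bmul := tens_act_bilinear (mul_bilinear A) (mul_bilinear B).
Let mulE := tens_act_tensor (mul_bilinear A) (mul_bilinear B).

Fact tensalg_mulDl : left_distributive tensalg_mul +%R.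
Proof. by move=> f g h; have := bmul.1 h 1 f g; rewrite !scale1r. Qed.
Fact tensalg_mulDr : right_distributive tensalg_mul +%R.
Proof. by move=> f g h; have := bmul.2 f 1 g h; rewrite !scale1r. Qed.
Fact tensalg_mul1 : left_id tensalg_one tensalg_mul.
Proof.
apply: tens_ext => [||x y]; [exact: bmul.2|by []|].
by rewrite /tensalg_mul mulE !mul1r.
Qed.
Fact tensalg_mulr1 : right_id tensalg_one tensalg_mul.
Proof.
apply: tens_ext => [||x y]; [exact: bmul.1|by []|].
by rewrite /tensalg_mul mulE !mulr1.
Qed.
Fact tensalg_mulA : associative tensalg_mul.
Proof.
move=> f g h; move: f; apply: tens_ext => [||a b].
- exact: bmul.1.
- by move=> c u v; rewrite /tensalg_mul !bmul.1.
move: g; apply: tens_ext => [||a' b'].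
- by move=> c u v; rewrite /tensalg_mul bmul.1 bmul.2.
- by move=> c u v; rewrite /tensalg_mul bmul.2 bmul.1.
move: h; apply: tens_ext => [||x y].
- by move=> c u v; rewrite /tensalg_mul !bmul.2.
- exact: bmul.2.
by rewrite /tensalg_mul !mulE !mulrA.
Qed.
HB.instance Definition _ := GRing.Zmodule_isPzRing.Build tensalg
  tensalg_mulA tensalg_mul1 tensalg_mulr1 tensalg_mulDl tensalg_mulDr.

Lemma tensalg_mul_tensor (a a' : A) (b b' : B) :
  (tensor a b : tensalg) * (tensor a' b' : tensalg) = tensor (a * a') (b * b').
Proof. exact: mulE. Qed.

End TensorAlgebra.

Section Restriction.
Variables (k : comNzRingType) (A : algType k) (M : lmodType A).

(* M as a k-module, by restriction of scalars along c |-> c%:A *)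
Definition restr : Type := M.
HB.instance Definition _ := GRing.Zmodule.on restr.

Definition restr_scale (c : k) (x : restr) : restr := (c%:A : A) *: (x : M).

Fact restr_scaleA a b x : restr_scale a (restr_scale b x) = restr_scale (a * b) x.
Proof. by rewrite /restr_scale scalerA -scalerAl mul1r scalerA. Qed.
Fact restr_scale1 : left_id 1 restr_scale.
Proof. by move=> x; rewrite /restr_scale scale1r scale1r. Qed.
Fact restr_scaleDr : right_distributive restr_scale +%R.
Proof. by move=> a x y; apply: scalerDr. Qed.
Fact restr_scaleDl x : {morph restr_scale^~ x : a b / a + b}.
Proof. by move=> a b; rewrite /restr_scale scalerDl scalerDl. Qed.
HB.instance Definition _ := GRing.Zmodule_isLmodule.Build k restr
  restr_scaleA restr_scale1 restr_scaleDr restr_scaleDl.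

Lemma restr_bilinear : bilinear_map
  (fun (a : A) (x : restr) => (a *: (x : M) : restr)).
Proof.
split=> [x|a] c u v.
  by rewrite scalerDl -[c *: u]mulr_algl -scalerA.
rewrite -[c *: u]/((c%:A : A) *: (u : M)) scalerDr scalerA.
by rewrite mulr_algr -mulr_algl -scalerA.
Qed.
End Restriction.

Section TensorOverAlgebra.
Variables (k : comNzRingType) (A B : algType k).
Variables (M : lmodType A) (N : lmodType B).

Definition tensmod : Type := tens (restr M) (restr N).
HB.instance Definition _ := GRing.Zmodule.on tensmod.

Definition tensmod_scale : tensalg A B -> tensmod -> tensmod :=
  tens_act (fun (a : A) (x : restr M) => (a *: (x : M) : restr M))
           (fun (b : B) (y : restr N) => (b *: (y : N) : restr N)).

Let bsc := tens_act_bilinear (restr_bilinear M) (restr_bilinear N).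
Let scE := tens_act_tensor (restr_bilinear M) (restr_bilinear N).
Let bmul := tens_act_bilinear (mul_bilinear A) (mul_bilinear B).
Let mulE := tens_act_tensor (mul_bilinear A) (mul_bilinear B).

Fact tensmod_scaleDl t : {morph tensmod_scale^~ t : f g / f + g}.
Proof. by move=> f g; have := bsc.1 t 1 f g; rewrite !scale1r. Qed.
Fact tensmod_scaleDr : right_distributive tensmod_scale +%R.
Proof. by move=> f t u; have := bsc.2 f 1 t u; rewrite !scale1r. Qed.
Fact tensmod_scale1 : left_id 1 tensmod_scale.
Proof.
apply: tens_ext => [||x y]; [exact: bsc.2|by []|].
by rewrite /tensmod_scale scE !scale1r.
Qed.
Fact tensmod_scaleA f g t :
  tensmod_scale f (tensmod_scale g t) = tensmod_scale (f * g) t.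
Proof.
rewrite -[f * g]/(tensalg_mul f g); move: f; apply: tens_ext => [||a b].
- exact: bsc.1.
- by move=> c u v; rewrite /tensmod_scale /tensalg_mul bmul.1 bsc.1.
move: g; apply: tens_ext => [||a' b'].
- by move=> c u v; rewrite /tensmod_scale bsc.1 bsc.2.
- by move=> c u v; rewrite /tensmod_scale /tensalg_mul bmul.2 bsc.1.
move: t; apply: tens_ext => [||x y].
- by move=> c u v; rewrite /tensmod_scale !bsc.2.
- exact: bsc.2.
by rewrite /tensmod_scale /tensalg_mul !(scE, mulE) !scalerA.
Qed.
HB.instance Definition _ := GRing.Zmodule_isLmodule.Build (tensalg A B) tensmod
  tensmod_scaleA tensmod_scale1 tensmod_scaleDr tensmod_scaleDl.

Lemma tensmod_scale_tensor (a : A) (b : B) (x : M) (y : N) :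
  (tensor a b : tensalg A B) *: (tensor (x : restr M) (y : restr N) : tensmod) =
  tensor (a *: x : restr M) (b *: y : restr N).
Proof. exact: scE. Qed.

End TensorOverAlgebra.

Definition faithful (A : pzRingType) (M : lmodType A) : Prop :=
  forall a : A, a != 0 -> exists x : M, a *: x != 0.

Definition lin_indep (R : pzRingType) (V : lmodType R) (X : set V) : Prop :=
  forall (s : seq V) (a : V -> R), uniq s -> (forall x, x \in s -> X x) ->
    \sum_(x <- s) a x *: x = 0 -> forall x, x \in s -> a x = 0.

Definition free_submodule (R : pzRingType) (V : lmodType R)
    (S : submodClosed V) : Prop :=
  exists2 X : set V, lin_indep X & S =i span X.

Definition finite_subsets_in_free (R : pzRingType) (V : lmodType R) : Prop :=
  forall F : set V, finite_set F ->
    exists2 S : submodClosed V, free_submodule S & F `<=` [set` S].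

Definition homs_separate (k : comNzRingType) (M : lmodType k) : Prop :=
  forall x y : M, x != y -> exists phi : {linear M -> k^o}, phi x != phi y.

Definition embeds_in_base (k : comNzRingType) (M : lmodType k) : Prop :=
  exists f : {linear M -> k^o}, injective f.

Definition faithful_with_zero_tensor (k : comNzRingType) (A B : algType k)
    (M : lmodType A) (N : lmodType B) : Prop :=
  [/\ faithful M, faithful N, exists f : tensalg A B, f != 0,
      forall t : tensmod M N, t = 0 & ~ faithful (tensmod M N)].

Definition PID (C : idomainType) : Prop :=
  forall I : set C, submod_closed ([in I] : {pred C^o}) ->
    exists c, I = [set a * c | a in [set: C]].

(* [idealr_closed] includes properness *)
Definition prime_ideal (C : comNzRingType) (p : set C) : Prop :=
  idealr_closed [in p] /\ prime_idealr_closed [in p].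

Definition algvia (k S : comNzRingType) (f : {rmorphism k -> S}) : Type := S.

Section AlgebraViaMorphism.
Variables (k S : comNzRingType) (f : {rmorphism k -> S}).

Local Notation algvia := (algvia f).
HB.instance Definition _ := GRing.ComNzRing.on algvia.

Definition algvia_scale (c : k) (x : algvia) : algvia := f c * x.

Fact algvia_scaleA a b x : algvia_scale a (algvia_scale b x) = algvia_scale (a * b) x.
Proof. by rewrite /algvia_scale mulrA rmorphM. Qed.
Fact algvia_scale1 : left_id 1 algvia_scale.
Proof. by move=> x; rewrite /algvia_scale rmorph1 mul1r. Qed.
Fact algvia_scaleDr : right_distributive algvia_scale +%R.
Proof. by move=> a x y; apply: mulrDr. Qed.
Fact algvia_scaleDl x : {morph algvia_scale^~ x : a b / a + b}.
Proof. by move=> a b; rewrite /algvia_scale rmorphD mulrDl. Qed.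
HB.instance Definition _ := GRing.Zmodule_isLmodule.Build k algvia
  algvia_scaleA algvia_scale1 algvia_scaleDr algvia_scaleDl.
Fact algvia_scaleAl (a : k) (x y : algvia) : a *: (x * y) = (a *: x) * y.
Proof. exact: mulrA. Qed.
HB.instance Definition _ := GRing.Lmodule_isLalgebra.Build k algvia algvia_scaleAl.
HB.instance Definition _ := GRing.Lalgebra_isComAlgebra.Build k algvia.
End AlgebraViaMorphism.

Section QuotientAlgebra.
Variables (k : comNzRingType) (I : idealr k).

Definition quotalg : Type :=
  algvia (\pi_{ideal_quot I} : {rmorphism k -> {ideal_quot I}}).
HB.instance Definition _ := GRing.ComAlgebra.on quotalg.

Definition qrmorph : {rmorphism k -> quotalg} := \pi_{ideal_quot I}.

(* A k-module killed by I, as a module over k/I. *)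
Section AnnihilatedModule.
Variable M : lmodType k.

Definition annmod of (forall (a : k) (x : M), a \in I -> a *: x = 0) : Type := M.

Hypothesis IM0 : forall (a : k) (x : M), a \in I -> a *: x = 0.
Local Notation annM := (annmod IM0).
HB.instance Definition _ := GRing.Zmodule.on annM.

Definition annmod_scale (a : quotalg) (x : annM) : annM :=
  repr (a : {ideal_quot I}) *: (x : M).

Lemma annmod_scale_pi a (x : annM) : annmod_scale (qrmorph a) x = a *: (x : M).
Proof.
apply/eqP; rewrite -subr_eq0 /annmod_scale -scalerBl IM0 //.
by rewrite Quotient.idealrBE reprK.
Qed.

Fact qrmorphP (a : quotalg) : exists b, a = qrmorph b.
Proof. by exists (repr (a : {ideal_quot I})); rewrite /qrmorph /= reprK. Qed.

Fact annmod_scaleA a b x : annmod_scale a (annmod_scale b x) = annmod_scale (a * b) x.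
Proof.
have [c ->] := qrmorphP a; have [d ->] := qrmorphP b.
by rewrite -rmorphM !annmod_scale_pi scalerA.
Qed.
Fact annmod_scale1 : left_id 1 annmod_scale.
Proof. by move=> x; rewrite -(rmorph1 qrmorph) annmod_scale_pi scale1r. Qed.
Fact annmod_scaleDr : right_distributive annmod_scale +%R.
Proof. by move=> a x y; apply: scalerDr. Qed.
Fact annmod_scaleDl x : {morph annmod_scale^~ x : a b / a + b}.
Proof.
move=> a b; have [c ->] := qrmorphP a; have [d ->] := qrmorphP b.
by rewrite -rmorphD !annmod_scale_pi scalerDl.
Qed.
HB.instance Definition _ := GRing.Zmodule_isLmodule.Build quotalg annM
  annmod_scaleA annmod_scale1 annmod_scaleDr annmod_scaleDl.
End AnnihilatedModule.

End QuotientAlgebra.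

(* Restricting [annmod] back to k recovers the original action. *)
Lemma restr_annmodE (k : comNzRingType) (I : idealr k) (M : lmodType k)
    (IM0 : forall (a : k) (x : M), a \in I -> a *: x = 0)
    (c : k) (x : restr (A := quotalg I) (annmod IM0)) : c *: x = c *: (x : M) :> M.
Proof.
rewrite -[LHS]/(annmod_scale (c *: 1 : quotalg I) (x : annmod IM0)).
rewrite -[c *: 1]/(qrmorph I c * 1) mulr1.
exact: annmod_scale_pi.
Qed.

Lemma mul0_swap (k : comNzRingType) (S T : {pred k}) :
  (forall u v : k, u \in S -> v \in T -> u * v = 0) ->
  forall v u : k, v \in T -> u \in S -> v * u = 0.
Proof. by move=> ST0 v u Tv Su; rewrite mulrC ST0. Qed.

Section IdealOverQuotient.
Variables (k : comNzRingType) (I : idealr k) (S : submodClosed k^o).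
Hypothesis SI0 : forall u v : k, u \in S -> v \in I -> u * v = 0.

Fact ideal_ann (a : k) (x : submod S) : a \in I -> a *: x = 0.
Proof.
move=> Ia; apply: val_inj; rewrite -[LHS]/(a * \val x) mulrC.
by apply: SI0; rewrite ?(valP x).
Qed.

(* When S I = 0, the ideal S of k as a module over k/I. *)
Definition ideal_over_quot : lmodType (quotalg I) := annmod ideal_ann.
End IdealOverQuotient.
Arguments ideal_over_quot {k} I S SI0.

Section Cplus.
Variables (C : comNzRingType) (Q : set (set C)).

Local Notation P := {malg C[{cmonom Q}]}.
Local Notation "'Y_ q" := (<< ucm q >> : P) (at level 8, q at level 2).

(* The ideal of C[Y_q | q in Q] generated by the c Y_q with c in q, so that
   C^+ is the quotient by it; each q in Q is itself a subset (an ideal) of C. *)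
Definition yrel : {pred P} :=
  span (V := P^o) [set f | exists (q : Q) (c : C), \val q c /\ f = c *: 'Y_q].

Let mcoeff1M (f g : P) : (f * g)@_mone = f@_mone * g@_mone.
Proof. exact: (rmorphM (mcoeff mone : {rmorphism P -> C})). Qed.

Lemma mcoeff1_yrel (f : P) : f \in yrel -> f@_mone = 0.
Proof.
move=> /asboolP[n [a [g [gq ->]]]]; rewrite raddf_sum big1 // => i _.
have [q [c [_ ->]]] := gq i.
rewrite -[a i *: _]/(a i * (c *: 'Y_q)) /= mcoeff1M mcoeffZ mcoeffU.
rewrite (_ : (_ == _) = false) ?mulr0 //.
by apply/negP => /eqP /(congr1 (fun m : {cmonom Q} => m q)); rewrite cmUU cm1.
Qed.

Lemma yrel_idealr_closed : idealr_closed yrel.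
Proof.
have [y0 yP] := span_submod_closed (V := P^o)
  [set f | exists (q : Q) (c : C), \val q c /\ f = c *: 'Y_q].
split=> //; apply/negP => /mcoeff1_yrel /eqP.
by rewrite mcoeff1 eqxx oner_eq0.
Qed.
HB.instance Definition _ := isIdealr.Build P yrel yrel_idealr_closed.

Definition Cplus : Type :=
  algvia ((\pi_{ideal_quot yrel} : P -> {ideal_quot yrel}) \o @malgC {cmonom Q} C).
HB.instance Definition _ := GRing.ComAlgebra.on Cplus.

Definition Cplus_pi : {rmorphism P -> Cplus} := \pi_{ideal_quot yrel}.

Definition yvar (q : Q) : Cplus := Cplus_pi 'Y_q.

(* The constant term: the C-algebra map C^+ -> C killing all the y_q. *)
Definition Cplus_aug (x : Cplus) : C := (repr (x : {ideal_quot yrel}))@_mone.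

Lemma Cplus_aug_pi f : Cplus_aug (Cplus_pi f) = f@_mone.
Proof.
apply/eqP; rewrite -subr_eq0 /Cplus_aug -mcoeffB mcoeff1_yrel //.
by rewrite Quotient.idealrBE reprK.
Qed.

Lemma Cplus_piP (x : Cplus) : exists f, x = Cplus_pi f.
Proof. by exists (repr (x : {ideal_quot yrel})); rewrite /Cplus_pi /= reprK. Qed.

Fact Cplus_aug_zmod_morphism : zmod_morphism Cplus_aug.
Proof.
move=> x y; have [f ->] := Cplus_piP x; have [g ->] := Cplus_piP y.
by rewrite -rmorphB !Cplus_aug_pi mcoeffB.
Qed.
HB.instance Definition _ := GRing.isZmodMorphism.Build Cplus C Cplus_aug
  Cplus_aug_zmod_morphism.

Fact Cplus_aug_monoid_morphism : monoid_morphism Cplus_aug.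
Proof.
split=> [|x y].
  by rewrite -(rmorph1 Cplus_pi) Cplus_aug_pi mcoeff1 eqxx.
have [f ->] := Cplus_piP x; have [g ->] := Cplus_piP y.
by rewrite -rmorphM !Cplus_aug_pi mcoeff1M.
Qed.
HB.instance Definition _ := GRing.isMonoidMorphism.Build Cplus C Cplus_aug
  Cplus_aug_monoid_morphism.

Lemma Cplus_aug_yvar q : Cplus_aug (yvar q) = 0.
Proof.
rewrite Cplus_aug_pi mcoeffU (_ : (_ == _) = false) //.
by apply/negP => /eqP /(congr1 (fun m : {cmonom Q} => m q)); rewrite cmUU cm1.
Qed.

(* The ideal of C^+ generated by the y_q with q in S. *)
Definition yideal (S : set (set C)) : {pred Cplus} :=
  span (V := Cplus^o) [set yvar q | q in [set q : Q | S (\val q)]].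

Lemma yideal_idealr_closed S : idealr_closed (yideal S).
Proof.
have [y0 yP] := span_submod_closed (V := Cplus^o)
  [set yvar q | q in [set q : Q | S (\val q)]].
split=> //; apply/negP => /asboolP[n [a [x [xS e]]]].
have /eqP := congr1 Cplus_aug e; rewrite rmorph1 raddf_sum big1 ?oner_eq0 //.
move=> i _; have [q _ <-] := xS i.
rewrite -[_ *: _]/(a i * yvar q) /=.
by rewrite (rmorphM (Cplus_aug : {rmorphism Cplus -> C})) /= Cplus_aug_yvar mulr0.
Qed.
HB.instance Definition _ S := isIdealr.Build Cplus (yideal S)
  (yideal_idealr_closed S).

Definition yidealmod (S : set (set C)) : Type :=
  submod (yideal S : submodClosed Cplus^o).
HB.instance Definition _ S : GRing.Lmodule Cplus (yidealmod S) :=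
  GRing.Lmodule.on (yidealmod S).

End Cplus.
Arguments yideal {C} Q S _.

(* The k-algebra Frac(C), for k = C^+, via C^+ -> C -> Frac(C) *)
Definition fracalg (C : idomainType) (Q : set (set C)) : Type :=
  algvia (@tofrac C \o @Cplus_aug C Q).
HB.instance Definition _ (C : idomainType) (Q : set (set C)) :=
  GRing.ComAlgebra.on (fracalg Q).

(* C/p as a C-module; for an ideal p, [span p] is p itself. *)
Definition residue (C : comNzRingType) (p : set C) : Type :=
  quotmod (span (V := C^o) p).
HB.instance Definition _ (C : comNzRingType) (p : set C) :=
  GRing.Lmodule.on (residue p).

Definition dsum_residues (C : comNzRingType) (S : set (set C)) : lmodType C :=
  dsum (fun p : S => residue (\val p)).

(* Main.v *)
From HB Require Import structures.
From mathcomp Require Import all_boot all_algebra.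
From mathcomp Require Import boolp classical_sets cardinality.
From mathcomp Require Import finmap monalg.
From mathcomp Require Import ring.
Require Import Defs.

(** In all three constructions the tensor product dies for one reason: an
    element x of M is killed by a scalar c by which any element y of N can be
    divided, y = c y', whence x ⊗ y = c x ⊗ y' = 0
    ([tens_eq0_of_divisible]).  In (i) and (ii), x is killed by a finite
    intersection of primes in [P0] and y by a finite intersection of primes in
    [P1].  Distinct nonzero primes of a principal ideal domain are comaximal,
    and so are these two intersections ([comaximal_finite_primes]); if
    a + b = 1 with a x = 0 and b y = 0, then y = a y.  In (iii), x is killed by
    a nonzero element of C, which is invertible on a vector space over the
    fraction field.

    Faithfulness rests on the fact that a nonzero element of C lies in only
    finitely many nonzero primes ([eq0_of_infinitely_many_primes]), so that
    only 0 kills infinitely many residue modules C/p.  For C^+ this is combined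
    with its explicit shape: since y_p y_q = 0 for p <> q and p y_p = 0, every
    element is a constant plus a combination of powers y_p^n with coefficients
    in C/p.  If it kills y_p, then its constant term and its coefficients at
    the powers of y_p lie in p ([mul_yvar_eq0]); if it kills y_p for
    all p in an infinite set S, then its constant term is 0 and only powers of
    the remaining variables survive ([yideal_annihilator]).

    Finally, A ⊗ B is nonzero because A and B both map to a common nonzero
    commutative k-algebra: C itself in (i) and (through the augmentation of
    C^+) in (ii), and the fraction field in (iii). *)

Set Implicit Arguments.
Unset Strict Implicit.

Import GRing.Theory.
Local Open Scope classical_set_scope.
Local Open Scope ring_scope.

(** * Prime ideals of a principal ideal domain *)

Section PrimeIdealSets.
Variables (C : comNzRingType) (p : set C) (prime_p : prime_ideal p).

Lemma prime_ideal0 : p 0.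
Proof. by case: prime_p => -[/set_mem]. Qed.

Lemma prime_ideal1 : ~ p 1.
Proof. by case: prime_p => -[_ /negP p1 _] _ /mem_set. Qed.

Lemma prime_idealP a u v : p u -> p v -> p (a * u + v).
Proof.
case: prime_p => -[_ _ pP] _ pu pv.
by apply/set_mem/pP; apply/mem_set.
Qed.

Lemma prime_idealD u v : p u -> p v -> p (u + v).
Proof. by rewrite -{2}[u]mul1r; exact: prime_idealP. Qed.

Lemma prime_idealMl a u : p u -> p (a * u).
Proof. by move=> pu; rewrite -[_ * _]addr0; apply/prime_idealP/prime_ideal0. Qed.

Lemma prime_idealM u v : p (u * v) -> p u \/ p v.
Proof.
case: prime_p => _ pP /mem_set /pP /orP[] /set_mem; by [left|right].
Qed.

Lemma prime_ideal_span (c : C) : (c : C^o) \in span (V := C^o) p -> p c.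
Proof.
move=> /asboolP[n [a [x [px ->]]]].
apply: big_ind => [||i _].
- exact: prime_ideal0.
- exact: prime_idealD.
- exact: prime_idealMl.
Qed.

Lemma prime_ideal_prod (I : Type) (s : seq I) (F : I -> C) :
  (forall i, ~ p (F i)) -> ~ p (\prod_(i <- s) F i).
Proof.
move=> pF; elim: s => [|i s IHs]; first by rewrite big_nil; exact: prime_ideal1.
by rewrite big_cons => /prime_idealM[/pF|].
Qed.

End PrimeIdealSets.

Section PrincipalIdeals.
Variables (C : idomainType) (pidC : PID C).
Implicit Types p q : set C.

(** The usual form of PID for the ideal generated by an arbitrary subset. *)
Lemma PID_span (X : set C) :
  exists d : C, forall x : C,
    (x : C^o) \in span (V := C^o) X <-> exists a, x = a * d.
Proof.
have [|d Xd] := @pidC [set x | (x : C^o) \in span (V := C^o) X].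
  have [s0 sP] := span_submod_closed (V := C^o) X.
  split=> [|a u v /set_mem ? /set_mem ?]; first exact/mem_set.
  exact/mem_set/sP.
exists d => x; have := congr1 (fun S => S x) Xd => /= ->.
by split=> [[a _ <-]|[a ->]]; exists a.
Qed.

Lemma prime_ideal_gen p : prime_ideal p ->
  exists d : C, forall x, p x <-> exists a, x = a * d.
Proof.
move=> pp; have [d dP] := PID_span p; exists d => x; rewrite -dP.
by split=> [|/prime_ideal_span]; [exact: span_gen|apply].
Qed.

(** Nonzero primes are maximal among principal ideals: if p = (c) lies in (d)
    then c = e d, and primality of p puts d or e in p; in the second case
    e = u c, and cancelling c shows that d is a unit. *)
Lemma prime_ideal_divisor p d : prime_ideal p -> p <> [set 0] ->
  (forall x, p x -> exists a, x = a * d) -> p d \/ exists u, u * d = 1.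
Proof.
move=> pp pn0 dP; have [c cP] := prime_ideal_gen pp.
have pc : p c by apply/cP; exists 1; rewrite mul1r.
have [e ce] := dP _ pc; have [pe|] : p e \/ p d.
- by apply: prime_idealM; rewrite -?ce.
- have [u eu] := (cP e).1 pe; right; exists u.
  apply: (@mulIf _ c) => [|]; last by rewrite mul1r {2}ce eu mulrAC.
  apply/eqP => c0; apply: pn0; apply/seteqP; split=> [x /cP[a ->]|x ->].
    by rewrite c0 mulr0.
  exact: prime_ideal0.
- by left.
Qed.

(** Let p + q = (d).  Unless d is a unit, maximality puts d in both p and q, so
    each of the two ideals contains the other. *)
Lemma prime_ideals_comaximal p q : prime_ideal p -> p <> [set 0] ->
  prime_ideal q -> q <> [set 0] -> p <> q ->
  exists a b, [/\ p a, q b & a + b = 1].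
Proof.
move=> pp pn0 pq qn0 pneq.
pose J : set C := [set x | exists a b, [/\ p a, q b & x = a + b]].
have [|d Jd] := @pidC J.
  split.
    by apply/mem_set; exists 0, 0; rewrite addr0; split=> //; exact: prime_ideal0.
  move=> c u v /set_mem[a [b [pa qb ->]]] /set_mem[a' [b' [pa' qb' ->]]].
  apply/mem_set; exists (c * a + a'), (c * b + b'); split; try exact: prime_idealP.
  by rewrite -[c *: _]/(c * _) mulrDr addrACA.
have pJ x : p x -> exists a, x = a * d.
  move=> px; have : J x.
    by exists x, 0; rewrite addr0; split=> //; exact: prime_ideal0.
  by rewrite Jd => -[a _ <-]; exists a.
have qJ x : q x -> exists a, x = a * d.
  move=> qx; have : J x.
    by exists 0, x; rewrite add0r; split=> //; exact: prime_ideal0.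
  by rewrite Jd => -[a _ <-]; exists a.
suff: exists u, u * d = 1.
  move=> [u ud]; have : J 1 by rewrite Jd; exists u.
  by case=> a [b [pa qb ->]]; exists a, b.
have [pd|//] := prime_ideal_divisor pp pn0 pJ.
have [qd|//] := prime_ideal_divisor pq qn0 qJ.
case: pneq; apply/seteqP.
by split=> x; [move=> /pJ|move=> /qJ] => -[a ->]; exact: prime_idealMl.
Qed.

Lemma prime_ideal_sub_eq p q : prime_ideal p -> p <> [set 0] ->
  prime_ideal q -> q <> [set 0] -> p `<=` q -> p = q.
Proof.
move=> pp pn0 pq qn0 pq_sub; apply: contrapT => neq.
have [a [b [pa qb ab]]] := prime_ideals_comaximal pp pn0 pq qn0 neq.
by apply: (prime_ideal1 pq); rewrite -ab; apply: prime_idealD => //; exact: pq_sub.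
Qed.

(** If c <> 0 lies in every p = (g_p) of S, the cofactors c / g_p generate an
    ideal, which is already generated by c / g_q for q in a finite subset of S.
    For p in S outside this subset, the product m of these finitely many g_q
    satisfies c | m (c / g_p), that is g_p | m, so that p contains some g_q and
    equals q, a contradiction. *)
Lemma eq0_of_infinitely_many_primes (S : set (set C)) (c : C) :
  (forall p, S p -> prime_ideal p /\ p <> [set 0]) -> infinite_set S ->
  (forall p, S p -> p c) -> c = 0.
Proof.
move=> Sp Sinf Sc; apply/eqP; apply: contrapT => /negP c0.
pose X : set C := [set e | exists p g,
  [/\ S p, p g, forall x, p x -> exists a, x = a * g & c = e * g]].
have XP p : S p -> exists e, X e /\
    exists g, [/\ p g, forall x, p x -> exists a, x = a * g & c = e * g].
  move=> pS; have [g gP] := prime_ideal_gen (Sp _ pS).1.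
  have [e ce] := (gP c).1 (Sc _ pS).
  have pg : p g by apply/gP; exists 1; rewrite mul1r.
  exists e; split; last by exists g; split=> // x /gP.
  by exists p, g; split=> // x /gP.
have [d dP] := PID_span X.
have /asboolP[n [a [x [Xx dE]]]] : (d : C^o) \in span (V := C^o) X.
  by apply/dP; exists 1; rewrite mul1r.
have [q qP] := choice Xx; have [g gP] := choice qP.
have [p pS pNq] : exists2 p, S p & forall i, q i <> p.
  apply: contrapT => H; apply: Sinf; apply: (@sub_finite_set _ _ (range q)).
    move=> p pS; apply: contrapT => Np; apply: H; exists p => // i qi.
    by apply: Np; exists i.
  exact: finite_image.
have [e [Xe [h [ph hP ceh]]]] := XP _ pS.
have [pp pn0] := Sp _ pS.
have [t et] : exists t, e = t * d by apply/dP/span_gen.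
pose m := \prod_i g i.
have Npm : ~ p m.
  apply: prime_ideal_prod => // i pg; apply: (pNq i).
  have [qS qg qgP _] := gP i; have [qq qn0] := Sp _ qS.
  by apply: prime_ideal_sub_eq => // y /qgP[b ->]; exact: prime_idealMl.
have [s ms] : exists s, m * d = s * c.
  rewrite dE mulr_sumr; apply: (big_ind (fun y => exists s, y = s * c)).
  - by exists 0; rewrite mul0r.
  - by move=> _ _ [s ->] [s' ->]; exists (s + s'); rewrite mulrDl.
  move=> i _; have [_ _ _ ->] := gP i.
  exists (a i * \prod_(j | j != i) g j).
  by rewrite /m (bigD1 i) //= -[a i *: x i]/(a i * x i); ring.
apply: Npm; have -> : m = t * s * h; last exact: prime_idealMl.
apply: (@mulIf _ e); first by apply: contra_neq c0; rewrite ceh => ->; rewrite mul0r.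
by rewrite {1}et mulrCA ms ceh; ring.
Qed.

End PrincipalIdeals.

(** With J an ideal, comaximality passes from each p in F to their
    intersection: modulo J, the product of elements congruent to 1 is congruent
    to 1. *)
Lemma comaximal_finite_meet (C : comNzRingType) (J : set C) (F : set (set C)) :
  J 0 -> (forall a u v, J u -> J v -> J (a * u + v)) ->
  finite_set F -> (forall p, F p -> prime_ideal p) ->
  (forall p, F p -> exists2 b, p b & J (b - 1)) ->
  exists2 b, (forall p, F p -> p b) & J (b - 1).
Proof.
move=> J0 JP /finite_seqP[s ->] {F}; elim: s => [|q s IHs] sp sJ.
  by exists 1 => //; rewrite subrr.
have [|p ps|b bs Jb] := IHs.
- by move=> p ps; apply: sp; rewrite /= inE ps orbT.
- by apply: sJ; rewrite /= inE ps orbT.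
have [c qc Jc] := sJ q (mem_head q s).
exists (b * c) => [p|].
  rewrite /= inE => /orP[/eqP ->|ps].
    exact: (prime_idealMl (sp _ (mem_head q s))).
  rewrite mulrC; apply: prime_idealMl; last exact: bs.
  by apply: sp; rewrite /= inE ps orbT.
have -> : b * c - 1 = b * (c - 1) + (b - 1) by ring.
exact: JP.
Qed.

(** [comaximal_finite_meet] is applied twice: for p in F against the members of
    G, then for the intersection of G against the members of F. *)
Lemma comaximal_finite_primes (C : idomainType) (F G : set (set C)) : PID C ->
  finite_set F -> finite_set G -> F `&` G = set0 ->
  (forall p, (F `|` G) p -> prime_ideal p /\ p <> [set 0]) ->
  exists a b, [/\ forall p, F p -> p a, forall q, G q -> q b & a + b = 1].
Proof.
move=> pidC fF fG FG0 FGp.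
have Fp p : F p -> prime_ideal p /\ p <> [set 0] by move=> ?; apply: FGp; left.
have Gp q : G q -> prime_ideal q /\ q <> [set 0] by move=> ?; apply: FGp; right.
pose J : set C := [set x | forall q, G q -> q x].
have [||//|p Fpp|p Fpp|a Fa Ja] := @comaximal_finite_meet C J F.
- by move=> q /Gp[qq _]; exact: prime_ideal0.
- move=> a u v Ju Jv q Gq; have [qq _] := Gp _ Gq.
  by apply: prime_idealP => //; [exact: Ju|exact: Jv].
- by have [] := Fp _ Fpp.
- have [pp pn0] := Fp _ Fpp.
  have [||//|q /Gp[]//|q Gq|b Gb pb] := @comaximal_finite_meet C p G.
  + exact: prime_ideal0.
  + exact: prime_idealP.
  + have [qq qn0] := Gp _ Gq.
    have [|a [b [pa qb ab]]] := prime_ideals_comaximal pidC pp pn0 qq qn0.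
      move=> pq; suff : (F `&` G) p by rewrite FG0.
      by split=> //; rewrite pq.
    exists b => //; have -> : b - 1 = -1 * a by rewrite -[b](addKr a) ab; ring.
    exact: prime_idealMl.
  exists (1 - b); first by rewrite -opprB -mulN1r; exact: prime_idealMl.
  move=> q Gq; have [qq _] := Gp _ Gq.
  have -> : 1 - b - 1 = -1 * b by ring.
  by apply: prime_idealMl => //; exact: Gb.
exists a, (1 - a); split=> [//|q Gq|]; last by ring.
have [qq _] := Gp _ Gq.
by rewrite -opprB -mulN1r; apply: prime_idealMl => //; exact: Ja.
Qed.

Lemma nonzero_in_finite_meet (C : idomainType) (F : set (set C)) : finite_set F ->
  (forall p, F p -> prime_ideal p /\ p <> [set 0]) ->
  exists2 c : C, c != 0 & forall p, F p -> p c.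
Proof.
move=> /finite_seqP[s ->] {F}; elim: s => [|p s IHs] sP.
  by exists 1; rewrite ?oner_neq0.
have [|c c0 sc] := IHs; first by move=> q qs; apply: sP; rewrite /= inE qs orbT.
have [pp pn0] := sP p (mem_head p s).
have [d pd d0] : exists2 d, p d & d != 0.
  apply: contrapT => H; apply: pn0; apply/seteqP; split=> [x px|x ->].
    by apply: contrapT => /eqP x0; apply: H; exists x.
  exact: prime_ideal0.
exists (c * d) => [|q]; first by rewrite mulf_neq0.
rewrite /= inE => /orP[/eqP ->|qs]; first exact: prime_idealMl.
rewrite mulrC; apply: prime_idealMl; last exact: sc.
by have [] : prime_ideal q /\ _ := sP q _; rewrite /= ?inE ?qs ?orbT.
Qed.

(** * Vanishing tensor products *)

Section TensorVanishing.
Variable k : comNzRingType.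

Lemma tens_eq0_of_divisible (M N : lmodType k) :
  (forall (x : M) (y : N), exists c y', c *: x = 0 /\ y = c *: y') ->
  forall t : tens M N, t = 0.
Proof.
move=> cxy t; have [n [a [x [y ->]]]] := tens_sum t.
rewrite big1 // => i _; have [c [y' [cx ->]]] := cxy (x i) (y i).
have tensor0l z : tensor (0 : M) z = 0.
  apply: (addrI (tensor 0 z)).
  by have := tensorPl 1 (0 : M) 0 z; rewrite !scale1r !addr0.
have tensor0r z : tensor z (0 : N) = 0.
  apply: (addrI (tensor z 0)).
  by have := tensorPr 1 z (0 : N) 0; rewrite !scale1r !addr0.
have := tensorPr c (x i) y' 0; rewrite addr0 => ->.
have := tensorPl c (x i) 0 y'; rewrite addr0 cx !tensor0l tensor0r !addr0 => <-.
exact: scaler0.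
Qed.

(** The bilinear map (a, b) |-> f a * g b sends (1, 1) to a nonzero element. *)
Lemma tensalg_neq0 (A B : algType k) (W : comAlgType k)
    (f : A -> W) (g : B -> W) :
  linear f -> linear g -> f 1 * g 1 != 0 -> exists t : tensalg A B, t != 0.
Proof.
move=> lf lg fg1; exists 1.
have bfg : bilinear_map (fun a b => f a * g b).
  split=> [b|a] c u v; rewrite ?lf ?lg.
    by rewrite mulrDl scalerAl.
  by rewrite mulrDr scalerAr.
apply: contra_neq fg1 => t0; have := tens_lift_tensor bfg 1 1.
rewrite -[tensor 1 1]/(1 : tensalg A B) t0 => <-.
have := tens_lift_is_linear bfg (-1) 0 0.
by rewrite scaler0 addr0 scaleN1r addNr.
Qed.

(** The two mechanisms combined; a nonzero A ⊗ B cannot act faithfully on a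
    zero module. *)
Lemma faithful_with_zero_tensorI (A B : algType k) (W : comAlgType k)
    (f : A -> W) (g : B -> W) (M : lmodType A) (N : lmodType B) :
  linear f -> linear g -> f 1 * g 1 != 0 -> faithful M -> faithful N ->
  (forall (x : M) (y : N), exists c y',
     (c%:A : A) *: x = 0 /\ y = (c%:A : B) *: y') ->
  faithful_with_zero_tensor M N.
Proof.
move=> lf lg fg1 fM fN cxy.
have AB := tensalg_neq0 lf lg fg1.
have MN0 (t : tensmod M N) : t = 0.
  exact: (@tens_eq0_of_divisible (restr M) (restr N) cxy).
split=> // fMN; have [a /fMN[t]] := AB.
by rewrite [_ *: _]MN0 eqxx.
Qed.

End TensorVanishing.

(** * Submodules of free modules *)

Lemma finite_subsets_in_free_regular (k : comNzRingType) :
  finite_subsets_in_free k^o.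
Proof.
move=> F _; exists (span (V := k^o) [set 1] : submodClosed k^o); last first.
  move=> x _; apply/asboolP; exists 1%N, (fun=> x), (fun=> 1).
  by rewrite big_ord1 [_ *: _]mulr1.
exists [set 1] => // -[|x [|y s]] a /=.
- by [].
- move=> _ s1; have -> : x = 1 by exact/s1/mem_head.
  by rewrite big_seq1 [_ *: _]mulr1 => a1 z; rewrite inE => /eqP ->.
- move=> /andP[xy _] s1; case/negP: xy.
  have -> : x = 1 by apply: s1; rewrite inE eqxx.
  by have <- : y = 1 :> k^o; [apply: s1; rewrite !inE eqxx orbT|rewrite inE eqxx].
Qed.

Lemma embeds_submod (k : comNzRingType) (S : submodClosed k^o) :
  embeds_in_base (submod S).
Proof.
have lv : linear (fun x : submod S => submod_val x : k^o) by [].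
pose f := HB.pack_for {linear submod S -> k^o}
  (fun x : submod S => submod_val x : k^o)
    (GRing.isLinear.Build k (submod S) k^o _ _ lv).
by exists f => x y xy; apply: val_inj.
Qed.

Lemma embeds_homs_separate (k : comNzRingType) (M : lmodType k) :
  embeds_in_base M -> homs_separate M.
Proof. by case=> f f_inj x y xy; exists f; rewrite (inj_eq f_inj). Qed.

(** * Ideals as modules over the base and over a quotient *)

(** Below, membership in an ideal S of k, given as a submodule of k^o, is written
    by application where S is later instantiated to an ideal of C^+: stated with
    [\in], it would require identifying the two carriers k and k^o. *)
Section IdealsOverBase.
Variables (k : comNzRingType) (S : submodClosed k^o).

Lemma scale_submod_eq0 (c : k) (x : submod S) :
  c * (submod_val x : k) = 0 -> (c%:A : k^o) *: x = 0.
Proof.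
move=> cx; apply: val_inj; rewrite -[LHS]/((c * 1) * submod_val x : k).
by rewrite mulr1.
Qed.

Lemma faithful_submod :
  (forall x : k, (forall u : k, (S : {pred k^o}) u -> x * u = 0) -> x = 0) ->
  faithful (submod S).
Proof.
move=> S0 x x0; apply: contrapT => H; case/eqP: x0; apply: S0 => u Su.
apply: contrapT => /eqP xu; apply: H; exists (Submod (Su : (u : k^o) \in S)).
by apply: contra_neq xu => /(congr1 (fun z : submod S => submod_val z)).
Qed.
End IdealsOverBase.

Section IdealsOverQuotients.
Variable k : comNzRingType.

Lemma faithful_ideal_over_quot (I : idealr k) (S : submodClosed k^o)
    (SI0 : forall u v : k, u \in S -> v \in I -> u * v = 0) :
  (forall x : k, (forall u, u \in S -> x * u = 0) -> x \in I) ->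
  faithful (ideal_over_quot I S SI0).
Proof.
move=> annS a; have [x ->] := qrmorphP a => xn0.
apply: contrapT => H; case/eqP: xn0.
suff xI : x \in I.
  by apply/eqP; rewrite -(rmorph0 (qrmorph I)) /qrmorph /= -Quotient.idealrBE subr0.
apply: annS => u Su; pose y : ideal_over_quot I S SI0 := Submod Su.
apply: contrapT => /eqP xu; apply: H; exists y.
apply: contra_neq xu => xy.
have := @annmod_scale_pi k I (submod S) (ideal_ann SI0) x y.
by rewrite [LHS]xy => /(congr1 (fun z : submod S => submod_val z)).
Qed.

Section QuotientLift.
Variables (I : idealr k) (W : comNzRingType) (f : {rmorphism k -> W}).
Hypothesis fI : forall x, x \in I -> f x = 0.

Definition quotalg_lift (a : quotalg I) : algvia f := f (repr (a : {ideal_quot I})).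

Lemma quotalg_lift_pi x : quotalg_lift (qrmorph I x) = f x.
Proof.
apply/eqP; rewrite -subr_eq0 /quotalg_lift -rmorphB fI //.
by rewrite Quotient.idealrBE reprK.
Qed.

Lemma quotalg_lift_linear : linear quotalg_lift.
Proof.
move=> c a b; have [x ->] := qrmorphP a; have [y ->] := qrmorphP b.
rewrite -[c *: qrmorph I x]/(qrmorph I c * qrmorph I x).
rewrite -rmorphM -rmorphD !quotalg_lift_pi.
by rewrite rmorphD rmorphM.
Qed.
End QuotientLift.

(** Both quotient algebras map to W through f, so that their tensor product is
    nonzero, while comaximal annihilators kill the tensor product of M and N.
    For the ideals of C^+ in item (ii), f is the augmentation. *)
Lemma ideals_over_quot_faithful_with_zero_tensor (IM IN : idealr k)
    (M N : submodClosed k^o) (W : comNzRingType) (f : {rmorphism k -> W})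
    (MN0 : forall u v : k, u \in M -> v \in IN -> u * v = 0)
    (NM0 : forall u v : k, u \in N -> v \in IM -> u * v = 0) :
  (forall x, x \in IM -> f x = 0) -> (forall x, x \in IN -> f x = 0) ->
  (forall x : k, (forall u : k, (M : {pred k^o}) u -> x * u = 0) -> x \in IN) ->
  (forall x : k, (forall u : k, (N : {pred k^o}) u -> x * u = 0) -> x \in IM) ->
  (forall u v : k, (M : {pred k^o}) u -> (N : {pred k^o}) v ->
     exists a b : k, [/\ a * u = 0, b * v = 0 & a + b = 1]) ->
  faithful_with_zero_tensor (A := quotalg IN) (B := quotalg IM)
    (ideal_over_quot IN M MN0) (ideal_over_quot IM N NM0).
Proof.
move=> fM fN annM annN MNab.
apply: (@faithful_with_zero_tensorI k _ _ (algvia f)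
  (@quotalg_lift IN W f) (@quotalg_lift IM W f)).
- exact: quotalg_lift_linear.
- exact: quotalg_lift_linear.
- rewrite -(rmorph1 (qrmorph IN)) -(rmorph1 (qrmorph IM)) !quotalg_lift_pi //.
  by rewrite rmorph1 mulr1 oner_neq0.
- exact: faithful_ideal_over_quot.
- exact: faithful_ideal_over_quot.
move=> x y; have [a [b [au bv ab]]] := MNab _ _
  (submod_valP (x : submod M)) (submod_valP (y : submod N)).
exists a, y; split.
  apply: etrans (@restr_annmodE k IN (submod M) (ideal_ann MN0) a x) _.
  exact/val_inj.
apply: esym; apply: etrans (@restr_annmodE k IM (submod N) (ideal_ann NM0) a y) _.
apply: val_inj; rewrite -[LHS]/(a * submod_val (y : submod N)).
by rewrite -[RHS]mul1r -ab mulrDl [b * _]bv addr0.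
Qed.

End IdealsOverQuotients.

(** * Direct sums of residue modules *)

Section ResidueSums.
Variables (C : comNzRingType) (S : set (set C)).
Hypothesis primeS : forall p, S p -> prime_ideal p.

Lemma scale_residue (p : set C) (c : C) (x : residue p) : p c -> c *: x = 0.
Proof.
move=> pc; have [v ->] := qpiP x; apply/eqP; rewrite -linearZ qpi_eq0.
by rewrite [_ *: _]mulrC; apply/rpredZ/span_gen.
Qed.

(** The class of 1 in the summand of index q.  Testing p == q inside the family
    avoids transporting that class along an equality of indices. *)
Definition residue_unit_fun (q : S) : dprod (fun p : S => residue (\val p)) :=
  fun p => if p == q then qpi (span (V := C^o) (\val p)) (1 : C^o) else 0.

Lemma residue_unit_supp q :
  residue_unit_fun q \in @fin_supp C S (fun p => residue (\val p)).
Proof.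
apply/asboolP; apply: (@sub_finite_set _ _ [set q]) => [p /=|].
  by rewrite /residue_unit_fun; case: eqP.
exact: finite_set1.
Qed.

Definition residue_unit q : dsum_residues S := Submod (residue_unit_supp q).

Lemma scale_residue_unit q c : c *: residue_unit q = 0 -> (\val q) c.
Proof.
move=> cq; have : (c *: residue_unit_fun q) q = 0.
  by have := congr1 (fun x : dsum_residues S => (submod_val x : dprod _) q) cq.
rewrite -[LHS]/(c *: residue_unit_fun q q) /residue_unit_fun eqxx.
move=> /eqP; rewrite -linearZ qpi_eq0 => /prime_ideal_span.
rewrite -[c *: _]/(c * 1) mulr1.
by apply; apply: primeS; apply: set_valP.
Qed.

Lemma faithful_dsum_residues :
  (forall c, (forall p : set C, S p -> p c) -> c = 0) ->
  faithful (dsum_residues S).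
Proof.
move=> S0 c c0; apply: contrapT => H; case/eqP: c0; apply: S0 => p Sp.
apply: (@scale_residue_unit (SigSub (mem_set Sp))).
by apply: contrapT => /eqP cp; apply: H; exists (residue_unit (SigSub (mem_set Sp))).
Qed.

Lemma dsum_residues_finite_annihilator (x : dsum_residues S) :
  exists F : set (set C), [/\ finite_set F, F `<=` S &
    forall c, (forall p : set C, F p -> p c) -> c *: x = 0].
Proof.
have /asboolP fx := submod_valP x.
exists [set \val p | p in [set p | (submod_val x : dprod _) p <> 0]]; split.
- exact: finite_image.
- by move=> _ [p _ <-]; apply: set_valP.
move=> c Fc; apply: val_inj; apply: functional_extensionality_dep => p.
rewrite -[LHS]/(c *: (submod_val x : dprod _) p) -[RHS]/(0 : residue (\val p)).
have [->|xp] := pselect ((submod_val x : dprod _) p = 0); first exact: scaler0.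
by apply: scale_residue; apply: Fc; exists p.
Qed.

End ResidueSums.

(** Item (i): the three algebras in sight are all C. *)
Lemma dsum_residues_faithful_with_zero_tensor (C : idomainType) (S T : set (set C)) :
  PID C -> infinite_set S -> infinite_set T -> S `&` T = set0 ->
  (forall p, (S `|` T) p -> prime_ideal p /\ p <> [set 0]) ->
  faithful_with_zero_tensor (A := C^o) (B := C^o)
    (dsum_residues S : lmodType C^o) (dsum_residues T : lmodType C^o).
Proof.
move=> pidC infS infT ST0 primeST.
have primeS p : S p -> prime_ideal p /\ p <> [set 0].
  by move=> ?; apply: primeST; left.
have primeT p : T p -> prime_ideal p /\ p <> [set 0].
  by move=> ?; apply: primeST; right.
apply: (@faithful_with_zero_tensorI C C^o C^o C^o id id).
- by [].
- by [].
- by rewrite mulr1 oner_neq0.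
- apply: faithful_dsum_residues => [p /primeS[]//|c].
  exact: eq0_of_infinitely_many_primes.
- apply: faithful_dsum_residues => [p /primeT[]//|c].
  exact: eq0_of_infinitely_many_primes.
move=> x y.
have [F [fF FS Fx]] := dsum_residues_finite_annihilator x.
have [G [fG GT Gy]] := dsum_residues_finite_annihilator y.
have [||a [b [Fa Gb ab]]] := comaximal_finite_primes pidC fF fG.
- by apply/seteqP; split=> // p [/FS Sp /GT Tp]; rewrite -ST0.
- by move=> p [/FS|/GT] ?; apply: primeST; [left|right].
exists a, y; rewrite -[a%:A]/(a * 1) mulr1; split; first exact: Fx.
by rewrite -[LHS]scale1r -ab scalerDl (Gy b) // addr0.
Qed.

(** * The algebra obtained by adjoining the variables *)

Section Monomials.
Variable I : choiceType.
Implicit Types (m : {cmonom I}) (i j : I).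

Lemma cmonom_factor m i : m i != 0%N ->
  exists m', m = mmul m' (ucm i) /\ forall j, j != i -> m' j = m j.
Proof.
move=> mi; exists (divcm m (ucm i)); split=> [|j ji].
  apply/eqP/cmP => j; rewrite cmM divcmE ucmE; case: eqP => [<-|_] /=.
    by rewrite subnK // lt0n.
  by rewrite subn0 addn0.
by rewrite divcmE ucmE eq_sym (negbTE ji) subn0.
Qed.

Lemma mmul_ucm_inj i : injective (fun m => mmul m (ucm i)).
Proof.
move=> m m' mm'; apply/eqP/cmP => j.
by have := congr1 (fun m => m j) mm'; rewrite /= !cmM => /addIn.
Qed.

Variable R : comNzRingType.
Implicit Types f : {malg R[{cmonom I}]}.

Lemma mcoeffMucm f m i : (f * << ucm i >>)@_(mmul m (ucm i)) = f@_m.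
Proof.
rewrite [f in f * _]monalgE mulr_suml raddf_sum [in RHS](monalgE f) raddf_sum /=.
apply: eq_bigr => m' _.
rewrite malgM_def fgmulUU !mcoeffU mulr1; congr (_ *+ _).
by rewrite (inj_eq (@mmul_ucm_inj i)).
Qed.

Lemma mcoeffMucm_out f m i : m i = 0%N -> (f * << ucm i >>)@_m = 0.
Proof.
move=> mi; rewrite [f in f * _]monalgE mulr_suml raddf_sum big1 //= => m' _.
rewrite malgM_def fgmulUU mcoeffU; case: eqP => // mm'.
by move: mi; rewrite -mm' cmM cmUU addn1.
Qed.

Lemma monalgUZ (c : R) m : << c *g m >> = c *: << m >> :> {malg R[{cmonom I}]}.
Proof. by rewrite -mul_malgC malgM_def fgmulUU mulr1 mul1m. Qed.

End Monomials.

Section CplusStructure.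
Variables (C : comNzRingType) (Q : set (set C)).
Hypothesis primeQ : forall p, Q p -> prime_ideal p.
Hypothesis comaxQ : forall p q, Q p -> Q q -> p <> q ->
  exists a b, [/\ p a, q b & a + b = 1].

Local Notation P := {malg C[{cmonom Q}]}.
Local Notation pi := (@Cplus_pi C Q).
Implicit Types (f g : P) (m : {cmonom Q}) (p q : Q) (x y : Cplus Q).

Lemma prime_ideal_val q : prime_ideal (\val q).
Proof. by apply: primeQ; apply: set_valP. Qed.

Lemma Cplus_pi_eq0 f : pi f = 0 <-> f \in @yrel C Q.
Proof.
rewrite -[X in X \in _]subr0 Quotient.idealrBE -[0 in X in X <-> _](rmorph0 pi).
by split=> [/eqP|/eqP].
Qed.

Lemma Cplus_scale_pi c f : c *: pi f = pi (c *: f).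
Proof. by rewrite -[c *: f]mul_malgC rmorphM. Qed.

Lemma scale_yvar q c : \val q c -> c *: yvar q = 0.
Proof.
move=> qc; rewrite Cplus_scale_pi; apply/Cplus_pi_eq0/span_gen.
by exists q, c.
Qed.

Lemma yvarM_neq p q : p != q -> yvar p * yvar q = 0.
Proof.
move=> pq; have [||/val_inj /eqP|a [b [pa qb ab]]] := @comaxQ (\val p) (\val q).
- exact: set_valP.
- exact: set_valP.
- by rewrite (negbTE pq).
rewrite -[LHS]scale1r -ab scalerDl scalerAl (scale_yvar pa) mul0r add0r.
by rewrite scalerAr (scale_yvar qb) mulr0.
Qed.

(** Of the generators c Y_q of the relations, only those with q = p reach a pure
    power of Y_p, and they contribute a multiple of some c in p. *)
Lemma yrel_mcoeff p m f : (forall q, q != p -> m q = 0%N) ->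
  f \in @yrel C Q -> (\val p) f@_m.
Proof.
move=> mp /asboolP[n [a [g [gP ->]]]]; rewrite raddf_sum.
have pp := prime_ideal_val p.
apply: big_ind => [||i _]; [exact: prime_ideal0|exact: prime_idealD|].
have [q [c [qc ->]]] := gP i.
change ((\val p) (a i * (c *: << ucm q >>))@_m); rewrite -scalerAr mcoeffZ.
have [<-|qp] := eqVneq q p.
  by rewrite mulrC; exact: (prime_idealMl (prime_ideal_val q)).
by rewrite mcoeffMucm_out ?mp // mulr0; exact: prime_ideal0.
Qed.

(** Multiplication by Y_p only shifts the powers of Y_p, the constant term
    becoming the coefficient of Y_p. *)
Lemma mul_yvar_eq0 p m f : (forall q, q != p -> m q = 0%N) ->
  pi f * yvar p = 0 -> (\val p) f@_m.
Proof.
move=> mp; rewrite -rmorphM => /Cplus_pi_eq0.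
move/(@yrel_mcoeff p (mmul m (ucm p))); rewrite mcoeffMucm; apply=> q qp.
by rewrite cmM ucmE mp // eq_sym (negbTE qp).
Qed.

Lemma pi_monom_factor c m q : m q != 0%N -> exists m',
  [/\ pi << c *g m >> = pi << c *g m' >> * yvar q
    & forall p, p != q -> m' p = m p].
Proof.
move=> mq; have [m' [-> m'E]] := cmonom_factor mq; exists m'; split=> //.
by rewrite -rmorphM malgM_def fgmulUU mulr1.
Qed.

Lemma yidealMl (S : set (set C)) x y : y \in yideal Q S -> x * y \in yideal Q S.
Proof. exact: (@rpredZ _ _ (yideal Q S : submodClosed (Cplus Q)^o)). Qed.

Lemma yideal_gen (S : set (set C)) q : S (\val q) -> yvar q \in yideal Q S.
Proof. by move=> Sq; apply: span_gen; exists q. Qed.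

(** Each monomial of x is treated separately.  Constants vanish since their
    coefficient is in all p of S; a monomial with a variable indexed by T is in
    the ideal; one with two distinct variables is 0; and a power of a single
    y_q with q in S has a coefficient in q, hence is 0 as well. *)
Lemma yideal_annihilator (S T : set (set C)) x :
  Q `<=` S `|` T -> S `<=` Q ->
  (forall c, (forall p : set C, S p -> p c) -> c = 0) ->
  (forall p, S (\val p) -> x * yvar p = 0) -> x \in yideal Q T.
Proof.
move=> QST SQ S0; have [f ->] := Cplus_piP x => fS.
rewrite [f]monalgE rmorph_sum /=; apply: rpred_sum => m _.
have [m1|/eqP m1] := pselect (m = mone).
  suff -> : f@_m = 0 by rewrite monalgU0 rmorph0 rpred0.
  apply: S0 => p Sp; pose q : Q := SigSub (mem_set (SQ _ Sp)).
  by apply: (@mul_yvar_eq0 q) => [r _|]; [rewrite m1 cm1|exact: fS].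
have [q mq] : exists q, m q != 0%N.
  apply: contrapT => H; case/eqP: m1; apply/eqP/cmP => q; rewrite cm1.
  by apply: contrapT => mq; apply: H; exists q; apply/eqP.
have [m' [-> m'E]] := pi_monom_factor f@_m mq.
have [Sq|Tq] := QST _ (set_valP q); last by apply/yidealMl/yideal_gen.
suff -> : pi << f@_m *g m' >> * yvar q = 0 by exact: rpred0.
have [[p [pq mp]]|H] := pselect (exists p, p != q /\ m p != 0%N).
  rewrite -m'E // in mp; have [m'' [-> _]] := pi_monom_factor f@_m mp.
  (* With its first factor abstracted, only y_p y_q can match the lemma. *)
  by move: (pi _) => u; rewrite -mulrA yvarM_neq // mulr0.
rewrite (monalgUZ f@_m) -Cplus_scale_pi -scalerAl scalerAr scale_yvar ?mulr0 //.
apply: mul_yvar_eq0 => [p pq|]; last exact: fS.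
by apply: contrapT => mp; apply: H; exists p; split=> //; apply/eqP.
Qed.

Lemma yideal_finite_annihilator (S : set (set C)) x : x \in yideal Q S ->
  exists F : set (set C), [/\ finite_set F, F `<=` S, F `<=` Q &
    forall c, (forall p : set C, F p -> p c) -> c *: x = 0].
Proof.
move=> /asboolP[n [a [y [yS ->]]]].
have /choice[q qP] i : exists q : Q, S (\val q) /\ yvar q = y i.
  by have [q Sq <-] := yS i; exists q.
exists (range (fun i => \val (q i))); split.
- exact: finite_image.
- by move=> _ [i _ <-]; have [] := qP i.
- by move=> _ [i _ <-]; apply: set_valP.
move=> c Fc; rewrite scaler_sumr big1 // => i _.
rewrite -[a i *: y i]/(a i * y i) scalerAr; have [_ <-] := qP i.
by rewrite scale_yvar ?mulr0 //; apply: Fc; exists i.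
Qed.

Lemma yidealmod_embeds (S : set (set C)) : embeds_in_base (yidealmod Q S).
Proof. exact: (@embeds_submod _ (yideal Q S : submodClosed (Cplus Q)^o)). Qed.

End CplusStructure.

(** * Ideals generated by the variables *)

Section YIdeals.
Variables (C : idomainType) (Q : set (set C)).
Hypothesis pidC : PID C.
Hypothesis primeQ : forall p, Q p -> prime_ideal p /\ p <> [set 0].

Let primeQ1 p : Q p -> prime_ideal p.
Proof. by case/primeQ. Qed.
Let comaxQ p q : Q p -> Q q -> p <> q ->
  exists a b, [/\ p a, q b & a + b = 1].
Proof.
by move=> /primeQ[pp pn0] /primeQ[qq qn0]; exact: prime_ideals_comaximal.
Qed.

Lemma yideal_comaximal_annihilators (S T : set (set C)) (u v : Cplus Q) :
  S `&` T = set0 -> yideal Q S u -> yideal Q T v ->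
  exists a b : Cplus Q, [/\ a * u = 0, b * v = 0 & a + b = 1].
Proof.
move=> ST0 /(@yideal_finite_annihilator C Q S)[F [fF FS FQ Fu]].
move=> /(@yideal_finite_annihilator C Q T)[G [fG GT GQ Gv]].
have [||a [b [Fa Gb ab]]] := comaximal_finite_primes pidC fF fG.
- by apply/seteqP; split=> // p [/FS Sp /GT Tp]; rewrite -ST0.
- by move=> p [/FQ|/GQ] /primeQ.
exists (a *: 1), (b *: 1); split.
- by rewrite -scalerAl mul1r; exact: Fu.
- by rewrite -scalerAl mul1r; exact: Gv.
- by rewrite -scalerDl ab scale1r.
Qed.

Lemma yideal_mul0 (S T : set (set C)) (u v : Cplus Q) :
  S `&` T = set0 -> u \in yideal Q S -> v \in yideal Q T -> u * v = 0.
Proof.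
move=> ST0 uS vT; have [a [b [au bv ab]]] := yideal_comaximal_annihilators ST0 uS vT.
by rewrite -[LHS]mul1r -ab mulrDl mulrA au mul0r add0r mulrCA bv mulr0.
Qed.

Lemma Cplus_aug_yideal (S : set (set C)) (u : Cplus Q) :
  u \in yideal Q S -> Cplus_aug u = 0.
Proof.
move=> /asboolP[n [a [x [xS ->]]]]; rewrite raddf_sum big1 // => i _.
have [q _ <-] := xS i; rewrite -[_ *: _]/(a i * yvar q) /=.
by rewrite (rmorphM (@Cplus_aug C Q)) /= Cplus_aug_yvar mulr0.
Qed.

Lemma yideal_annihilates (S T : set (set C)) (x : Cplus Q) :
  Q `<=` S `|` T -> S `<=` Q -> infinite_set S ->
  (forall u : Cplus Q, yideal Q S u -> x * u = 0) -> x \in yideal Q T.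
Proof.
move=> QST SQ infS xS; apply: (yideal_annihilator primeQ1 comaxQ QST SQ).
  by move=> c; apply: eq0_of_infinitely_many_primes => // p /SQ /primeQ.
by move=> p Sp; apply/xS/yideal_gen.
Qed.

Lemma yideals_faithful_with_zero_tensor (S T : set (set C))
    (ST0 : forall u v : Cplus Q, u \in yideal Q S -> v \in yideal Q T -> u * v = 0) :
  S `&` T = set0 -> Q = S `|` T -> infinite_set S -> infinite_set T ->
  faithful_with_zero_tensor
    (A := quotalg (yideal Q T)) (B := quotalg (yideal Q S))
    (ideal_over_quot (yideal Q T) (yideal Q S) ST0)
    (ideal_over_quot (yideal Q S) (yideal Q T) (mul0_swap ST0)).
Proof.
move=> STd QST infS infT.
apply: (ideals_over_quot_faithful_with_zero_tensor (f := @Cplus_aug C Q)).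
- exact: Cplus_aug_yideal.
- exact: Cplus_aug_yideal.
- by move=> x; apply: yideal_annihilates => //; rewrite QST // => p; left.
- move=> x; apply: yideal_annihilates => //; rewrite QST; last by move=> p; right.
  by move=> p []; [right|left].
move=> u v uS vT.
have [||a [b [au bv ab]]] := yideal_comaximal_annihilators (u := u) (v := v) STd.
(* Unfolding exposes, on both sides, the span that the ideal consists of. *)
- by rewrite /= in uS; rewrite /yideal; apply: uS.
- by rewrite /= in vT; rewrite /yideal; apply: vT.
by exists a, b; split; [exact: au|exact: bv|exact: ab].
Qed.

(** Item (iii).  No variable is left outside the infinite set Q, so the
    annihilator of M is the ideal generated by the empty set of variables. *)
Lemma yideal_frac_faithful_with_zero_tensor (N : lmodType {fraction C}) :
  infinite_set Q -> (exists v : N, v != 0) ->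
  faithful_with_zero_tensor (k := Cplus Q) (A := (Cplus Q)^o) (B := fracalg Q)
    (yidealmod Q Q) N.
Proof.
move=> infQ [v v0].
apply: (@faithful_with_zero_tensorI (Cplus Q) (Cplus Q)^o (fracalg Q) (fracalg Q)
  (fun x => x%:A) id).
- by move=> c x y; rewrite scalerDl scalerA.
- by [].
- by rewrite scale1r mulr1 oner_neq0.
- apply: faithful_submod => x xQ.
  suff /asboolP[n [a [y [yS ->]]]] : x \in yideal Q set0.
    by rewrite big1 // => i _; have [] := yS i.
  apply: (@yideal_annihilates Q set0) => //.
- move=> b b0; exists v; apply: contra_neq v0 => bv.
  by rewrite -[v]scale1r -(@mulVf {fraction C} b) // -scalerA bv scaler0.
move=> x y.
have [F [fF _ FQ Fx]] := yideal_finite_annihilator (submod_valP x).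
have [c c0 Fc] : exists2 c : C, c != 0 & forall p, F p -> p c.
  by apply: nonzero_in_finite_meet => // p /FQ /primeQ.
have cE : (c *: (1 : Cplus Q))%:A = tofrac c :> fracalg Q.
  rewrite -[LHS]/(tofrac (Cplus_aug (c *: (1 : Cplus Q))) * 1) mulr1.
  by rewrite -[c *: 1]/(Cplus_pi Q c%:MP * 1) mulr1 Cplus_aug_pi malgCK.
exists (c *: 1), ((tofrac c)^-1 *: y); split; last first.
  by rewrite cE scalerA mulfV ?scale1r // tofrac_eq0.
apply: scale_submod_eq0.
by rewrite -scalerAl mul1r; exact: Fx.
Qed.

End YIdeals.

Unset Implicit Arguments.

Theorem lemma3 (C : idomainType) (P0 P1 : set (set C))
    (pidC : PID C)
    (infC : infinite_set [set p : set C | prime_ideal p])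
    (infP0 : infinite_set P0) (infP1 : infinite_set P1)
    (P01 : P0 `&` P1 = set0)
    (primeP : forall p, (P0 `|` P1) p -> prime_ideal p /\ p <> [set 0]) :
  [/\ let A : algType C := C^o in let B : algType C := C^o in
      let M : lmodType A := dsum_residues P0 in
      let N : lmodType B := dsum_residues P1 in
      [/\ faithful_with_zero_tensor (A := A) (B := B) M N,
          finite_subsets_in_free A & finite_subsets_in_free B],
      let Q := P0 `|` P1 in
      let k := Cplus Q in
      let IM := yideal Q P0 in
      let IN := yideal Q P1 in
      let M : lmodType k := yidealmod Q P0 in
      let N : lmodType k := yidealmod Q P1 in
      let A := quotalg IN in let B := quotalg IM in
      (exists MN0 : (forall u v : k, u \in IM -> v \in IN -> u * v = 0),
         let MA : lmodType A := ideal_over_quot IN IM MN0 in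
         let NB : lmodType B := ideal_over_quot IM IN (mul0_swap MN0) in
         faithful_with_zero_tensor (A := A) (B := B) MA NB) /\
      [/\ embeds_in_base M, embeds_in_base N,
          homs_separate M & homs_separate N]
    & let Q := P0 `|` P1 in
      let k := Cplus Q in
      let A : algType k := k^o in
      let M : lmodType A := yidealmod Q Q in
      let B := fracalg Q in
      forall N : lmodType {fraction C}, (exists v : N, v != 0) ->
        [/\ faithful_with_zero_tensor (A := A) (B := B) M N,
            finite_subsets_in_free A & homs_separate (k := k) M]].
Proof.
have infQ : infinite_set (P0 `|` P1) by rewrite finite_setU => -[].
split.
- split; try exact: finite_subsets_in_free_regular.
  exact: dsum_residues_faithful_with_zero_tensor.
- split; last first.
    split; try exact: yidealmod_embeds;
      exact: embeds_homs_separate (yidealmod_embeds _ _).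
  exists (fun u v => @yideal_mul0 C (P0 `|` P1) pidC primeP P0 P1 u v P01).
  exact: yideals_faithful_with_zero_tensor.
- move=> Q k A M B N N0; split.
  + exact: yideal_frac_faithful_with_zero_tensor.
  + exact: finite_subsets_in_free_regular.
  + exact: embeds_homs_separate (yidealmod_embeds _ _).
Qed.
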